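(* Let $d,m,n$ be positive integers and let $\mathbf{R}=(R_1,\dots,R_d)$ be an $(m,n)$-isosymmetric commuting $d$-tuple of bounded linear operators on $\mathcal{H}$. Then the following hold. (1) $\displaystyle \sigma_{ja}(\mathbf{R})\subset \partial\mathbb{B}(\mathbb{C}^d)\cup\Big\{(\mu_1,\dots,\mu_d)\in\mathbb{C}^d:\ \sum_{k=1}^d\mu_k\in\mathbb{R}\Big\}.$ (2) $\displaystyle \sigma_{jp}(\mathbf{R})\subset \partial\mathbb{B}(\mathbb{C}^d)\cup\Big\{(\mu_1,\dots,\mu_d)\in\mathbb{C}^d:\ \sum_{k=1}^d\mu_k\in\mathbb{R}\Big\}.$ (3) Let $\mu=(\mu_1,\dots,\mu_d)$ and $\mu'=(\mu_1',\dots,\mu_d')$ be in $\sigma_{ja}(\mathbf{R})$ such that $\sum_{j=1}^d\mu_j\overline{\mu_j'}\neq1$ and $\sum_{j=1}^d(\mu_j-\overline{\mu_j'})\neq0$. If $(u_k)_k$ and $(v_k)_k$ are two sequences of unit vectors in $\mathcal{H}$ such that $\|(R_j-\mu_j)u_k\|\to0$ and $\|(R_j-\mu_j')v_k\|\to0$ as $k\to\infty$ for $j=1,\dots,d$, then $\langle u_k\,|\,v_k\rangle\to0$ as $k\to\infty$. (4) Let $\mu=(\mu_1,\dots,\mu_d)$ and $\mu'=(\mu_1',\dots,\mu_d')$ be in $\sigma_{jp}(\mathbf{R})$ such that $\sum_{j=1}^d\mu_j\overline{\mu_j'}\neq1$ and $\sum_{j=1}^d(\mu_j-\overline{\mu_j'})\neq0$.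 If $u,v\in\mathcal{H}$ satisfy $(R_j-\mu_j)u=0$ and $(R_j-\mu_j')v=0$ for $j=1,\dots,d$, then $\langle u\,|\,v\rangle=0$.
   Context: $\mathcal{H}$ is a separable complex Hilbert space with inner product $\langle\cdot\,|\,\cdot\rangle$. A $d$-tuple $\mathbf{R}=(R_1,\dots,R_d)$ of bounded linear operators on $\mathcal{H}$ is commuting if $R_iR_j=R_jR_i$ for all $i,j$. For $\gamma=(\gamma_1,\dots,\gamma_d)\in\mathbb{N}_0^d$ put $|\gamma|=\sum_j\gamma_j$, $\gamma!=\prod_j\gamma_j!$, $\mathbf{R}^\gamma=R_1^{\gamma_1}\cdots R_d^{\gamma_d}$ and $\mathbf{R}^{*\gamma}=(R_1^* )^{\gamma_1}\cdots(R_d^* )^{\gamma_d}$ (zeroth powers are $I$). For a commuting tuple $\mathbf{R}$ and integers $m,n\ge 0$ define $$\mathbf{M}_m(\mathbf{R})=\sum_{j=0}^m(-1)^{m-j}\binom{m}{j}\sum_{|\gamma|=j}\frac{j!}{\gamma!}\mathbf{R}^{*\gamma}\mathbf{R}^\gamma,$$ $$\Lambda_{m,n}(\mathbf{R})=\sum_{j=0}^n(-1)^{n-j}\binom{n}{j}\Big(\sum_{i=1}^dR_i^*\Big)^j\,\mathbf{M}_m(\mathbf{R})\,\Big(\sum_{i=1}^dR_i\Big)^{n-j}.$$ For positive integers $m,n$, a commuting tuple $\mathbf{R}$ is $(m,n)$-isosymmetric if $\Lambda_{m,n}(\mathbf{R})=0$. The joint point spectrum $\sigma_{jp}(\mathbf{R})$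 is the set of $\mu\in\mathbb{C}^d$ for which there is a nonzero $u\in\mathcal{H}$ with $(R_l-\mu_l)u=0$ for all $l=1,\dots,d$. The joint approximate point spectrum $\sigma_{ja}(\mathbf{R})$ is the set of $\mu\in\mathbb{C}^d$ for which there is a sequence $(u_k)_k$ in $\mathcal{H}$ with $\|u_k\|=1$ and $(R_l-\mu_l)u_k\to0$ as $k\to\infty$ for every $l=1,\dots,d$. Also $\partial\mathbb{B}(\mathbb{C}^d)=\{\mu\in\mathbb{C}^d:\ \sum_{l=1}^d|\mu_l|^2=1\}$. *)

(* Defs.v *)
From HB Require Import structures.
From mathcomp Require Import all_boot all_order all_algebra.
From mathcomp Require Import complex.
From mathcomp Require Import all_classical all_reals all_analysis.

Set Implicit Arguments.
Unset Strict Implicit.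
Unset Printing Implicit Defensive.

Import Order.TTheory GRing.Theory Num.Theory.
Import numFieldNormedType.Exports.

Local Open Scope classical_set_scope.
Local Open Scope ring_scope.

(* Complex Hilbert spaces.  A form in [{dot H for Num.conj}] is linear in its
   first argument, conjugate-linear in its second one, and positive definite. *)
HB.mixin Record isHilbert (R : realType) H of CompleteNormedModule R[i] H := {
  inner : {dot H for (@Num.conj R[i])} ;
  inner_norm : forall u : H, inner u u = `|u| ^+ 2
}.

#[short(type="hilbertType")]
HB.structure Definition Hilbert (R : realType) :=
  {H of isHilbert R H & CompleteNormedModule R[i] H}.

Definition separable (T : topologicalType) :=
  exists2 D : set T, countable D & dense D.

Section Operators.
Variables (R : realType) (H : hilbertType R) (d : nat).
Local Notation C := R[i].
Implicit Types (A : H -> H) (T : 'I_d -> {linear H -> H}).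

Definition bounded_operator A : Prop :=
  exists M : C, forall u, `|A u| <= M * `|u|.

(* For a bounded operator the adjoint exists by the Riesz representation
   theorem and is unique; the default value is only reached otherwise. *)
Definition adjoint A : H -> H :=
  xget (fun=> 0) [set B | forall u v, inner (A u) v = inner u (B v)].

Definition commuting_tuple T : Prop :=
  forall i j u, T i (T j u) = T j (T i u).

Definition multi_power (m : nat) (A : 'I_d -> H -> H) (g : {ffun 'I_d -> 'I_m}) :
    H -> H :=
  \big[(fun f g : H -> H => f \o g)/id]_(i < d) iter (g i) (A i).

(* The entries of a multi-index of length j are at most j, so these are ranged
   over as finite functions from 'I_d to 'I_j.+1. *)
Definition M_op (m : nat) T (u : H) : H :=
  \sum_(j < m.+1) ((-1) ^+ (m - j) * 'C(m, j)%:R : C) *: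
    \sum_(g : {ffun 'I_d -> 'I_j.+1} | (\sum_i g i == j)%N)
      (j`!%:R / (\prod_i (g i)`!)%:R : C) *:
        multi_power (fun i => adjoint (T i)) g
          (multi_power (fun i => T i : H -> H) g u).

Definition sum_op (A : 'I_d -> H -> H) (u : H) : H := \sum_(i < d) A i u.

Definition Lambda_op (m n : nat) T (u : H) : H :=
  \sum_(j < n.+1) ((-1) ^+ (n - j) * 'C(n, j)%:R : C) *:
    iter j (sum_op (fun i => adjoint (T i)))
      (M_op m T (iter (n - j) (sum_op (fun i => T i : H -> H)) u)).

Definition isosymmetric (m n : nat) T : Prop :=
  commuting_tuple T /\ forall u, Lambda_op m n T u = 0.

Definition joint_point_spectrum T : set 'rV[C]_d :=
  [set mu | exists2 u : H, u != 0 & forall l, T l u - mu 0 l *: u = 0].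

Definition joint_approx_spectrum T : set 'rV[C]_d :=
  [set mu | exists2 u : nat -> H, (forall k, `|u k| = 1) &
     forall l, (fun k => T l (u k) - mu 0 l *: u k) @ \oo --> (0 : H)].

End Operators.

Definition unit_sphere (R : realType) (d : nat) : set 'rV[R[i]]_d :=
  [set mu | \sum_(l < d) `|mu 0 l| ^+ 2 = 1].

Definition real_sum (R : realType) (d : nat) : set 'rV[R[i]]_d :=
  [set mu | \sum_(k < d) mu 0 k \is Num.real].

(* Main.v *)
(** If [u_k] and [v_k] are approximate joint eigenvectors of [T] for [mu] and
    [mu'], moving the adjoints across the inner product replaces every factor
    [T_i] by [mu_i] and every factor [T_i^*] by [conj mu'_i], up to a term
    tending to 0. By the binomial and multinomial theorems
      [<Lambda u_k, v_k>
         = (sum conj mu' - sum mu)^n (sum mu conj mu' - 1)^m <u_k, v_k> + o(1)],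
    and the left-hand side vanishes. Hence [<u_k, v_k> -> 0] as soon as the two
    factors are nonzero; the inclusions are the case [v = u], [mu' = mu], and
    point spectra correspond to constant sequences. The adjoints exist by the
    Riesz theorem, obtained by minimizing [|u|^2 - 2 Re (f u)]. *)

Require Import Defs.
From mathcomp Require Import all_boot all_order all_algebra.
From mathcomp Require Import complex ring.
From mathcomp Require Import all_classical all_reals all_analysis.
Import Order.TTheory GRing.Theory Num.Theory.
Import numFieldNormedType.Exports.
Local Open Scope classical_set_scope.
Local Open Scope ring_scope.

Set Implicit Arguments.
Unset Strict Implicit.

(** * The multinomial theorem *)

(** Exponentials turn sums into products: the coefficient of ['X^j] in the product of the series
    exp(a_i X) is computed once by multiplicativity and once by expanding the product. *)
Lemma multinomial (F : numFieldType) (d j : nat) (a : 'I_d -> F) :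
  \sum_(g : {ffun 'I_d -> 'I_j.+1} | (\sum_i g i == j)%N)
    (j`!%:R / (\prod_i (g i)`!)%:R) * \prod_i a i ^+ g i =
  (\sum_i a i) ^+ j.
Proof.
(* Truncating exp(xX) at degree [j] leaves the coefficients up to [j] of products unchanged. *)
pose e (x : F) : {poly F} := \sum_(k < j.+1) (x ^+ k / k`!%:R) *: 'X^k.
have f0 k : k`!%:R != 0 :> F by rewrite pnatr_eq0 -lt0n fact_gt0.
have coef_e x k : (k <= j)%N -> (e x)`_k = x ^+ k / k`!%:R.
  move=> lekj; rewrite coef_sum (bigD1 (inord k)) //= inordK ?ltnS //.
  rewrite coefZ coefXn eqxx mulr1 big1 ?addr0 // => i nik.
  rewrite coefZ coefXn; case: eqP => [kE|_]; last by rewrite mulr0.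
  by case/eqP: nik; apply/val_inj; rewrite /= inordK ?ltnS.
have coef_prod_e : forall k, (k <= j)%N ->
    (\prod_i e (a i))`_k = (\sum_i a i) ^+ k / k`!%:R.
  pose K (p : {poly F}) x := forall k, (k <= j)%N -> p`_k = x ^+ k / k`!%:R.
  apply: (big_ind2 K) => [k _|p x q y Kp Kq k lekj|i _]; last exact: coef_e.
    by rewrite coef1; case: k => [|k]; rewrite /= ?fact0 ?divr1 // expr0n mul0r.
  rewrite coefM addrC exprDn mulr_suml; apply: eq_bigr => i _.
  have leik : (i <= k)%N by rewrite -ltnS ltn_ord.
  rewrite Kp ?(leq_trans leik) // Kq ?(leq_trans (leq_subr _ _)) //.
  rewrite -(bin_fact leik) -mulr_natr !natrM.
  have b0 : 'C(k, i)%:R != 0 :> F by rewrite pnatr_eq0 -lt0n bin_gt0.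
  by field; rewrite !f0 b0.
have /(congr1 (fun x => x * j`!%:R)) := coef_prod_e j (leqnn j).
(* The product of sums expands over all functions [g]; the monomial of [g] has degree the sum of its
   entries, so only total degree [j] survives. *)
rewrite divfK // => <-; rewrite bigA_distr_bigA /= coef_sum big_distrl /=.
rewrite [RHS](bigID (fun g : {ffun 'I_d -> 'I_j.+1} => \sum_i g i == j)%N) /=.
rewrite [X in _ = _ + X]big1 ?addr0 => [|g gj].
  apply: eq_bigr => g /eqP gj; rewrite scaler_prod prodrXr gj coefZ coefXn eqxx.
  by rewrite big_split /= prodfV natr_prod mulr1; ring.
by rewrite scaler_prod prodrXr coefZ coefXn eq_sym (negbTE gj) mulr0 mul0r.
Qed.

(** * Sequences tending to zero *)

Section NullSequences.
Variable K : numFieldType.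

Lemma cvg0_le (V W : normedModType K) (c : K) (x : nat -> V) (y : nat -> W) :
  (forall k, `|y k| <= c * `|x k|) -> x @ \oo --> (0 : V) -> y @ \oo --> (0 : W).
Proof.
move=> xy /cvgr0Pnorm_lt x0; apply/cvgr0Pnorm_lt => e e0.
(* The scalar [c] may vanish or fail to be real, so the division uses its norm plus 1, which is
   always positive. *)
have c0 : 0 < `|c| + 1 by rewrite ltr_wpDl.
apply: filterS (x0 (e / (`|c| + 1)) (divr_gt0 e0 c0)) => k.
rewrite ltr_pdivlMr // mulrC; apply: le_lt_trans.
apply: (@le_trans _ _ (`|c| * `|x k|)); last by rewrite ler_wpM2r // lerDl.
have cx : c * `|x k| \is Num.real by rewrite ger0_real // (le_trans _ (xy k)).
by apply: le_trans (xy k) _; rewrite -[`|x k| in leRHS]normr_id -normrM real_ler_norm.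
Qed.

Lemma cvg0D (V : normedModType K) (x y : nat -> V) :
  x @ \oo --> (0 : V) -> y @ \oo --> (0 : V) ->
  (fun k => x k + y k) @ \oo --> (0 : V).
Proof. by move=> x0 y0; rewrite -(addr0 (0 : V)); exact: cvgD. Qed.

Lemma cvg0Z (V : normedModType K) (c : K) (x : nat -> V) :
  x @ \oo --> (0 : V) -> (fun k => c *: x k) @ \oo --> (0 : V).
Proof. by apply: (@cvg0_le _ _ `|c|) => k; rewrite -normrZ. Qed.

End NullSequences.

(** * Positive definite forms and the Riesz energy *)

Section Dot.
Variables (C : numClosedFieldType) (U : lmodType C) (form : {dot U for (@Num.conj C)}).
Implicit Types u v z : U.

Lemma dot_conj u v : form u v = (form v u)^*.
Proof. by rewrite hermC /= mul1r. Qed.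

(** The two arguments are replaced one after the other; for approximate eigenvectors both error
    terms are small. *)
Lemma dot_subZ a b u u' v v' :
  form u' v' - a * b^* * form u v = form (u' - a *: u) v' + a * form u (v' - b *: v).
Proof. by rewrite linearBl linearBr (linearZl_LR form) linearZr_LR /=; ring. Qed.

(* Unlike [sesquilinear.CauchySchwarz], no finite dimension is needed. *)
Lemma dot_Cauchy_Schwarz u v : `|form u v| ^+ 2 <= form u u * form v v.
Proof.
rewrite normCK.
have [->|v0] := eqVneq v 0; first by rewrite !linear0r !mul0r ?mulr0.
have vv : 0 < form v v by rewrite dnorm_gt0.
have sJ : (form v v)^* = form v v by rewrite -dot_conj.
(* The vector is the component of [u] orthogonal to [v]. *)
have := dnorm_ge0 form (u - (form u v / form v v) *: v).
rewrite dnormB dnormZ linearZr_LR /= normCK.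
rewrite !rmorphM /= !fmorphV /= !(conjCK, sJ) => ge0.
rewrite -subr_ge0 -(pmulr_lge0 _ (_ : 0 < (form v v)^-1)) ?invr_gt0 //.
apply: le_trans ge0 _; rewrite le_eqVlt; apply/orP; left; apply/eqP.
by field; rewrite gt_eqF.
Qed.

(** Stated with the midpoint, since that is the competitor against which two near-minimizers are
    tested. *)
Lemma dot_parallelogram u v :
  form (u - v) (u - v) = 2 * form u u + 2 * form v v
    - 4 * form (2^-1 *: (u + v)) (2^-1 *: (u + v)).
Proof.
rewrite dnormZ dnormB dnormD ger0_norm ?invr_ge0 ?ler0n //.
by field.
Qed.

(* The functional whose minimizer represents [f]. *)
Definition riesz_energy (f : U -> C) u : C := form u u - (f u + (f u)^*).

Lemma riesz_energy_real f u : riesz_energy f u \is Num.real.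
Proof.
apply: rpredB; first by rewrite ger0_real ?dnorm_ge0.
by rewrite CrealE rmorphD /= conjCK addrC.
Qed.

(* The affine part of the energy cancels in the parallelogram law, whence
   minimizing sequences are Cauchy. *)
Lemma riesz_energy_near (f : {scalar U}) (e e' : C) w w' :
  (forall z, riesz_energy f w <= riesz_energy f z + e) ->
  (forall z, riesz_energy f w' <= riesz_energy f z + e') ->
  form (w - w') (w - w') <= 2 * (e + e').
Proof.
set z := 2^-1 *: (w + w') => /(_ z) le1 /(_ z) le2.
rewrite dot_parallelogram -/z.
have -> : 2 * form w w + 2 * form w' w' - 4 * form z z =
    2 * (riesz_energy f w + riesz_energy f w' - 2 * riesz_energy f z).
  have fz : f z = 2^-1 * (f w + f w') by rewrite linearZ linearD.
  have fzJ : (f z)^* = 2^-1 * ((f w)^* + (f w')^*).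
    by rewrite fz rmorphM fmorphV rmorph_nat rmorphD.
  by rewrite /riesz_energy fzJ fz; field.
rewrite ler_pM2l ?ltr0n // lerBlDr.
apply: le_trans (lerD le1 le2) _.
by rewrite le_eqVlt; apply/orP; left; apply/eqP; ring.
Qed.

(** Moving from [w] along [z] by the best step lowers the energy by the squared norm of
    [f z - form z w] divided by [form z z]; near-minimality caps this gain by [e]. *)
Lemma riesz_energy_near_min (f : {scalar U}) (e : C) w z :
  (forall z, riesz_energy f w <= riesz_energy f z + e) ->
  `|f z - form z w| ^+ 2 <= e * form z z.
Proof.
move=> wmin; have [->|z0] := eqVneq z 0.
  by rewrite linear0 !linear0l subr0 normr0 expr0n mulr0.
pose D := f z - form z w.
(* This [t] minimizes the energy of [w + t *: z]; the existential keeps it opaque until [tE] is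
   rewritten. *)
have [t tE] : {t | t = D^* / form z z} by exists (D^* / form z z).
have zz : 0 < form z z by rewrite dnorm_gt0.
have zJ : (form z z)^* = form z z by rewrite -dot_conj.
have tJ : t^* = D / form z z by rewrite tE rmorphM fmorphV /= conjCK zJ.
have := wmin (w + t *: z); rewrite -subr_ge0.
have ft : f (w + t *: z) = f w + t * (D + form z w).
  by rewrite addrC linearP addrC subrK.
rewrite /riesz_energy ft dnormD dnormZ linearZr_LR /= (dot_conj w z) !normCK.
rewrite !(rmorphM, rmorphD) /= ?conjCK tJ tE => ge0.
rewrite -/D -subr_ge0 -(pmulr_lge0 _ (_ : 0 < (form z z)^-1)) ?invr_gt0 //.
apply: le_trans ge0 _; rewrite le_eqVlt; apply/orP; left; apply/eqP.
by field; rewrite gt_eqF.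
Qed.

End Dot.

(** * Bounds and limits with complex-valued constants *)

Lemma bounded_operator_ge0 (R : realType) (V W : normedModType R[i]) (A : V -> W) :
  (exists M : R[i], forall u, `|A u| <= M * `|u|) ->
  exists2 M : R[i], 0 <= M & forall u, `|A u| <= M * `|u|.
Proof.
case=> M AM; exists `|M| => // u.
have Mu : M * `|u| \is Num.real by rewrite ger0_real // (le_trans _ (AM u)).
by apply: le_trans (AM u) _; rewrite -[`|u| in leRHS]normr_id -normrM real_ler_norm.
Qed.

Lemma near_infty_natSinv_ltC (R : realType) (e : R[i]) : 0 < e ->
  \forall k \near \oo, k.+1%:R^-1 < e.
Proof.
move=> e0; have eE : (complex.Re e)%:C%C = e by rewrite RRe_real ?gtr0_real.
have Re_e0 : 0 < complex.Re e by rewrite -ltcR eE.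
have := near_infty_natSinv_lt (PosNum Re_e0); apply: filterS => k /=.
by rewrite -ltcR eE fmorphV rmorph_nat.
Qed.

Lemma cvg_sqr_le (R : realType) (V : normedModType R[i]) (c : R[i]) (x : nat -> V) :
  (forall k, `|x k| ^+ 2 <= k.+1%:R^-1 * c) -> x @ \oo --> (0 : V).
Proof.
(* The bound at index 0, where the factor is 1, forces [c] to be nonnegative. *)
move=> xc; have c0 : 0 <= c.
  by rewrite -[c]mul1r -[1 in leRHS]invr1 (le_trans _ (xc 0%N)) ?exprn_ge0.
have c1 : 0 < c + 1 by rewrite ltr_wpDl.
apply/cvgr0Pnorm_lt => e e0.
have := near_infty_natSinv_ltC (divr_gt0 (exprn_gt0 2 e0) c1).
apply: filterS => k; rewrite ltr_pdivlMr // => lek.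
rewrite -ltr_sqr ?nnegrE ?(ltW e0) //; apply: le_lt_trans lek.
by apply: le_trans (xc k) _; rewrite ler_wpM2l ?invr_ge0 ?ler0n ?lerDl.
Qed.

(** * Riesz representation and existence of adjoints *)

Section Hilbert.
Variables (R : realType) (H : hilbertType R).
Local Notation C := R[i].
Implicit Types (u v w z : H).

Lemma Cauchy_Schwarz u v : `|inner u v| <= `|u| * `|v|.
Proof.
rewrite -ler_sqr ?nnegrE ?mulr_ge0 // exprMn -!inner_norm.
exact: dot_Cauchy_Schwarz.
Qed.

Lemma riesz_energy_minimizing (f : H -> C^o) (e : C) :
  (exists M : C, forall u, `|f u| <= M * `|u|) -> 0 < e ->
  exists w, forall z, riesz_energy inner f w <= riesz_energy inner f z + e.
Proof.
move=> /bounded_operator_ge0[M M0 fM] e0.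
have energyE u :
    riesz_energy inner f u = (complex.Re (riesz_energy inner f u))%:C%C.
  by rewrite RRe_real ?riesz_energy_real.
have eE : e = (complex.Re e)%:C%C by rewrite RRe_real ?gtr0_real.
(* The energy takes real values, so its infimum is formed in [R], which is totally ordered and
   complete. *)
pose E := range (fun u => complex.Re (riesz_energy inner f u)).
have infE : has_inf E.
  split; first by exists (complex.Re (riesz_energy inner f 0)), 0.
  (* Completing the square: the energy is at least the squared norm of [u] minus [2 M] times its
     norm, hence at least [- M ^+ 2]. *)
  exists (complex.Re (- M ^+ 2)) => _ [u _ <-].
  rewrite -lecR -energyE RRe_real ?rpredN ?ger0_real ?exprn_ge0 //.
  have le2 : f u + (f u)^* <= 2 * (M * `|u|).
    apply: (@le_trans _ _ `|f u + (f u)^*|).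
      by rewrite real_ler_norm // CrealE rmorphD /= conjCK addrC.
    by apply: le_trans (ler_normD _ _) _; rewrite norm_conjC mulr_natl mulr2n lerD ?fM.
  rewrite /riesz_energy inner_norm -subr_ge0.
  have -> : `|u| ^+ 2 - (f u + (f u)^*) - - M ^+ 2 =
     (`|u| - M) ^+ 2 + (2 * (M * `|u|) - (f u + (f u)^*)) by ring.
  rewrite addr_ge0 ?subr_ge0 // -realEsqr rpredB ?ger0_real //.
have [|_ [w _ <-] wE] := inf_adherent _ infE (eps := complex.Re e).
  by rewrite -ltcR -eE.
exists w => z; rewrite energyE [X in _ <= X + _]energyE eE -rmorphD lecR.
apply/ltW/(lt_le_trans wE); rewrite lerD2r; apply: ge_inf; first by case: infE.
by exists z.
Qed.

Lemma cvg_inner_r (x : nat -> H) w z : x @ \oo --> w ->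
  (fun k => inner z (x k) : C^o) @ \oo --> (inner z w : C^o).
Proof.
have ineq k : `|inner z (x k) - inner z w| <= `|z| * `|x k - w|.
  by rewrite -linearBr Cauchy_Schwarz.
move=> /subr_cvg0 xw; apply: (iffLR (subr_cvg0 (V := C^o) _ _)).
exact: (@cvg0_le C H C^o `|z| (fun k => x k - w)) xw.
Qed.

Lemma riesz (f : {scalar H}) :
  (exists M : C, forall u, `|f u| <= M * `|u|) ->
  exists w, forall z, f z = inner z w.
Proof.
move=> fM.
have eps_gt0 k : 0 < k.+1%:R^-1 :> C by rewrite invr_gt0 ltr0n.
have [w wmin] := choice (fun k => riesz_energy_minimizing fM (eps_gt0 k)).
have w_cauchy : cauchy (w @ \oo).
  apply: cauchy_exP => e e0.
  (* Near-minimizers with errors below [e ^+ 2 / 4] lie at squared distance below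
     [2 * (e ^+ 2 / 4 + e ^+ 2 / 4) = e ^+ 2]. *)
  have e4 : 0 < e ^+ 2 / 4 by rewrite divr_gt0 ?exprn_gt0 ?ltr0n.
  have [N _ Ne] := near_infty_natSinv_ltC e4.
  have Ne' : N.+1%:R^-1 < e ^+ 2 / 4 by apply: Ne => /=.
  exists (w N), N => // k /Ne /= ke; rewrite -ball_normE /ball_ /=.
  rewrite -ltr_sqr ?nnegrE ?(ltW e0) // -inner_norm.
  apply: le_lt_trans (riesz_energy_near (wmin N) (wmin k)) _.
  have -> : e ^+ 2 = 2 * (e ^+ 2 / 4 + e ^+ 2 / 4) by field.
  by rewrite ltr_pM2l ?ltr0n // ltrD.
have wl : cvg (w @ \oo) by apply: (iffLR (cauchy_cvgP _)).
 exists (lim (w @ \oo)) => z.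
have fz : (fun k => inner z (w k) : C^o) @ \oo --> (f z : C^o).
  apply: (iffLR (subr_cvg0 (V := C^o) _ _)).
  apply: (@cvg_sqr_le _ C^o (inner z z)) => k.
  rewrite -normrN opprB; exact: riesz_energy_near_min (wmin k).
exact: (norm_cvg_unique (V := C^o) fz (cvg_inner_r wl)).
Qed.

Lemma adjointP (A : {linear H -> H}) u v : bounded_operator A ->
  inner (A u) v = inner u (adjoint A v).
Proof.
move=> /bounded_operator_ge0[M M0 AM].
(* Representers chosen for each [y] form a function [B], so the default value of [xget] is not
   reached. *)
suff /choice[B AB] : forall y, exists w, forall x, inner (A x) y = inner x w.
  by rewrite /adjoint; case: xgetP => [_ -> -> //|/(_ B)[] x y]; exact: AB.
move=> y; pose f : {scalar H} := applyr (@inner R H) y \o A.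
apply: (riesz (f := f)).
exists (M * `|y|) => x; apply: le_trans (Cauchy_Schwarz _ _) _.
by rewrite mulrAC ler_wpM2r ?AM.
Qed.

End Hilbert.

(** * Approximate eigenvalues under sums and compositions *)

Section OperatorCalculus.
Variables (R : realType) (H : hilbertType R).
Local Notation C := R[i].

(** Closure properties shared by the [T i] acting on [u] and their adjoints acting on [v], so that
    powers and sums are treated once for both. *)
Record symbol_calculus (P : (H -> H) -> C -> Prop) : Prop := SymbolCalculus {
  symbol_id : P id 1;
  symbol_zero : P (fun=> 0) 0;
  symbol_comp : forall A B a b, P A a -> P B b -> P (A \o B) (a * b);
  symbol_add : forall A B a b, P A a -> P B b -> P (fun x => A x + B x) (a + b)
}.

Section Closure.
Variables (P : (H -> H) -> C -> Prop) (Pcalc : symbol_calculus P).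

Lemma symbol_iter n A a : P A a -> P (iter n A) (a ^+ n).
Proof.
move=> PA; elim: n => [|n IHn]; first by rewrite expr0; exact: symbol_id.
by rewrite exprS; exact: (symbol_comp Pcalc PA IHn).
Qed.

Lemma symbol_multi_power d j (A : 'I_d -> H -> H) (a : 'I_d -> C)
    (g : {ffun 'I_d -> 'I_j}) :
  (forall i, P (A i) (a i)) -> P (multi_power A g) (\prod_i a i ^+ g i).
Proof.
move=> PA; apply: (big_ind2 P); first exact: symbol_id.
  by move=> *; exact: symbol_comp.
by move=> i _; exact: symbol_iter.
Qed.

Lemma symbol_sum_op d (A : 'I_d -> H -> H) (a : 'I_d -> C) :
  (forall i, P (A i) (a i)) -> P (sum_op A) (\sum_i a i).
Proof.
move=> PA; rewrite /sum_op; elim: (index_enum _) => [|i s IHs].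
  under eq_fun do rewrite big_nil.
  by rewrite big_nil; exact: symbol_zero.
under eq_fun do rewrite big_cons.
by rewrite big_cons; exact: symbol_add.
Qed.

End Closure.

Definition approx_eigen (u : nat -> H) (A : H -> H) (a : C) :=
  [/\ linear A, bounded_operator A &
      (fun k => A (u k) - a *: u k) @ \oo --> (0 : H)].

(** Only the operator [A] on the other side of the inner product acts approximately as a scalar on
    [v]; nothing is asserted about [B] applied to [v]. *)
Definition coapprox_eigen (v : nat -> H) (B : H -> H) (b : C) :=
  exists2 A, (forall x y, inner (B x) y = inner x (A y)) & approx_eigen v A b^*.

Lemma approx_eigen_calculus u : symbol_calculus (approx_eigen u).
Proof.
split.
- split => //; first by exists 1 => x; rewrite mul1r.
  under eq_fun do rewrite scale1r subrr.
  exact: cvg_cst.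
- split; first by move=> a x y; rewrite scaler0 addr0.
    by exists 0 => x; rewrite normr0 mul0r.
  under eq_fun do rewrite scale0r subrr.
  exact: cvg_cst.
- move=> A B a b [Al /bounded_operator_ge0[M M0 AM] Au] [Bl [N BN] Bu].
  split; first by move=> c x y /=; rewrite Bl Al.
    exists (M * N) => x; apply: le_trans (AM _) _.
    by rewrite -mulrA ler_wpM2l.
  have A0 : A 0 = 0 by have := Al (-1) 0 0; rewrite scaler0 addr0 scaleN1r addNr.
  have AZ c x : A (c *: x) = c *: A x by rewrite -[c *: x]addr0 Al A0 addr0.
  have AB x y : A (x - y) = A x - A y by rewrite -scaleN1r addrC Al scaleN1r addrC.
  (* The first term tends to 0 because [A] is bounded, the second by the hypothesis on [A]. *)
  have -> : (fun k => (A \o B) (u k) - (a * b) *: u k) =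
      (fun k => A (B (u k) - b *: u k) + b *: (A (u k) - a *: u k)).
    apply/funext => k /=.
    by rewrite AB AZ scalerBr scalerA [b * a]mulrC addrA subrK.
  apply: cvg0D; last exact: cvg0Z.
  exact: (cvg0_le (fun k => AM _) Bu).
- move=> A B a b [Al [M AM] Au] [Bl [N BN] Bu]; split.
  + by move=> c x y; rewrite Al Bl scalerDr addrACA.
  + exists (M + N) => x; rewrite mulrDl; apply: le_trans (ler_normD _ _) _.
    exact: lerD.
  + under eq_fun do rewrite scalerDl opprD addrACA.
    exact: cvg0D.
Qed.

Lemma coapprox_eigen_calculus v : symbol_calculus (coapprox_eigen v).
Proof.
have Pv := approx_eigen_calculus v; split.
- by exists id => //; rewrite conjC1; exact: symbol_id.
- exists (fun=> 0); last by rewrite conjC0; exact: symbol_zero.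
  by move=> x y; rewrite linear0l linear0r.
- move=> A B a b [A' AA' Aa] [B' BB' Bb]; exists (B' \o A') => [x y /=|].
    by rewrite AA' BB'.
  by rewrite mulrC rmorphM; exact: symbol_comp.
- move=> A B a b [A' AA' Aa] [B' BB' Bb]; exists (fun y => A' y + B' y).
    by move=> x y; rewrite linearDl linearDr /= AA' BB'.
  by rewrite rmorphD; exact: symbol_add.
Qed.

End OperatorCalculus.

(** * Asymptotics of inner products with operator polynomials *)

Section FormSymbol.
Variables (R : realType) (H : hilbertType R) (u v : nat -> H).
Local Notation C := R[i].
(** Boundedness, rather than unit norm, also covers constant sequences at arbitrary joint
    eigenvectors. *)
Hypotheses (u_bnd : exists K : C, forall k, `|u k| <= K)
           (v_bnd : exists K : C, forall k, `|v k| <= K).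

Lemma cvg_inner_approx_eigen A a B b : approx_eigen u A a -> approx_eigen v B b ->
  (fun k => inner (A (u k)) (B (v k)) - a * b^* * inner (u k) (v k) : C^o)
    @ \oo --> (0 : C^o).
Proof.
move=> [_ _ Au] [_ /bounded_operator_ge0[N N0 BN] Bv].
have [K uK] := u_bnd; have [L vL] := v_bnd.
have -> : (fun k => inner (A (u k)) (B (v k)) - a * b^* * inner (u k) (v k) : C^o) =
    (fun k => inner (A (u k) - a *: u k) (B (v k))
              + a *: (inner (u k) (B (v k) - b *: v k) : C^o)).
  by apply/funext => k; exact: dot_subZ.
apply: (@cvg0D C C^o).
  apply: (@cvg0_le C H C^o (N * L)); last exact: Au.
  move=> k; apply: le_trans (Cauchy_Schwarz _ _) _; rewrite mulrC ler_wpM2r //.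
  by apply: le_trans (BN _) _; rewrite ler_wpM2l.
apply: (@cvg0Z C C^o).
apply: (@cvg0_le C H C^o K); last exact: Bv.
by move=> k; apply: le_trans (Cauchy_Schwarz _ _) _; rewrite ler_wpM2r.
Qed.

(* The quantification over [A] and [B] lets operators be absorbed on either side
   of [F] without knowing that [F] is linear. *)
Definition form_symbol (F : H -> H) (c : C) :=
  forall A a B b, approx_eigen u A a -> approx_eigen v B b ->
  (fun k => inner (F (A (u k))) (B (v k)) - a * c * b^* * inner (u k) (v k) : C^o)
    @ \oo --> (0 : C^o).

(** [A] is absorbed into the test operator on the [u] side, and [B], moved across the inner product,
    into the one on the [v] side. *)
Lemma form_symbol_comp A a F c B b :
  approx_eigen u A a -> coapprox_eigen v B b -> form_symbol F c ->
  form_symbol (B \o F \o A) (a * c * b).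
Proof.
move=> Aa [B' BB' Bb] Fc A1 a1 B1 b1 Aa1 Bb1.
have := Fc _ _ _ _ (symbol_comp (approx_eigen_calculus u) Aa Aa1)
                   (symbol_comp (approx_eigen_calculus v) Bb Bb1).
have -> : a * a1 * c * (b^* * b1)^* = a1 * (a * c * b) * b1^*.
  by rewrite rmorphM /= conjCK; ring.
by under eq_fun do rewrite /= -BB'.
Qed.

Lemma form_symbol_id : form_symbol id 1.
Proof. by move=> A a B b Aa Bb; rewrite mulr1; exact: cvg_inner_approx_eigen. Qed.

Lemma form_symbol_scale t F c :
  form_symbol F c -> form_symbol (fun x => t *: F x) (t * c).
Proof.
move=> Fc A a B b Aa Bb.
have -> : (fun k => inner (t *: F (A (u k))) (B (v k)) -
                     a * (t * c) * b^* * inner (u k) (v k) : C^o) =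
    (fun k => t *: (inner (F (A (u k))) (B (v k)) -
                     a * c * b^* * inner (u k) (v k) : C^o)).
  apply/funext => k; rewrite linearZl_LR /GRing.scale /= mulrBr; congr (_ - _).
  by rewrite -!mulrA mulrCA.
by apply: (@cvg0Z C C^o); exact: Fc.
Qed.

Lemma form_symbol_add F G c e :
  form_symbol F c -> form_symbol G e -> form_symbol (fun x => F x + G x) (c + e).
Proof.
move=> Fc Ge A a B b Aa Bb.
have -> : (fun k => inner (F (A (u k)) + G (A (u k))) (B (v k)) -
                     a * (c + e) * b^* * inner (u k) (v k) : C^o) =
    (fun k => (inner (F (A (u k))) (B (v k)) - a * c * b^* * inner (u k) (v k) : C^o) +
              (inner (G (A (u k))) (B (v k)) - a * e * b^* * inner (u k) (v k) : C^o)).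
  by apply/funext => k; rewrite linearDl mulrDr !mulrDl opprD addrACA.
by apply: (@cvg0D C C^o); [exact: Fc | exact: Ge].
Qed.

Lemma form_symbol_sum (I : Type) (s : seq I) (P : pred I) (F : I -> H -> H) (c : I -> C) :
  (forall i, P i -> form_symbol (F i) (c i)) ->
  form_symbol (fun x => \sum_(i <- s | P i) F i x) (\sum_(i <- s | P i) c i).
Proof.
move=> Fc; elim: s => [|i s IHs].
  move=> A a B b _ _; under eq_fun do rewrite !big_nil linear0l mulr0 !mul0r subrr.
  exact: cvg_cst.
under eq_fun do rewrite big_cons.
rewrite big_cons; case: ifP => // Pi.
exact: form_symbol_add (Fc i Pi) IHs.
Qed.

Variables (d : nat) (T : 'I_d -> {linear H -> H}) (mu nu : 'I_d -> C).
Hypotheses (u_eig : forall i, approx_eigen u (T i) (mu i))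
           (v_eig : forall i, coapprox_eigen v (adjoint (T i)) (nu i)).

Lemma form_symbol_M_op m : form_symbol (M_op m T) ((\sum_i mu i * nu i - 1) ^+ m).
Proof.
(* The scalar is expanded into the shape of [M_op]; the middle factor 1 is the symbol of the
   identity between the two multi-powers. *)
have -> : (\sum_i mu i * nu i - 1) ^+ m = \sum_(j < m.+1)
    ((-1) ^+ (m - j) * 'C(m, j)%:R) *
    \sum_(g : {ffun 'I_d -> 'I_j.+1} | (\sum_i g i == j)%N)
      (j`!%:R / (\prod_i (g i)`!)%:R) *
        (\prod_i mu i ^+ g i * 1 * \prod_i nu i ^+ g i).
  rewrite addrC exprDn; apply: eq_bigr => j _.
  rewrite -[LHS]mulr_natr mulrAC -multinomial; congr (_ * _).
  apply: eq_bigr => g _; rewrite mulr1 -big_split /=; congr (_ * _).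
  by apply: eq_bigr => i _; rewrite exprMn.
apply: form_symbol_sum => j _; apply: form_symbol_scale.
apply: form_symbol_sum => g _; apply: form_symbol_scale.
have Ag := symbol_multi_power (approx_eigen_calculus u) g u_eig.
have Bg := symbol_multi_power (coapprox_eigen_calculus v) g v_eig.
exact: form_symbol_comp Ag Bg form_symbol_id.
Qed.

Lemma form_symbol_Lambda_op m n :
  form_symbol (Lambda_op m n T)
    ((\sum_i nu i - \sum_i mu i) ^+ n * (\sum_i mu i * nu i - 1) ^+ m).
Proof.
(* The binomial expansion mirrors [Lambda_op]: the sign goes with the power [n - j] of the sum of
   [mu], the power [j] with the adjoints. *)
have -> : (\sum_i nu i - \sum_i mu i) ^+ n * (\sum_i mu i * nu i - 1) ^+ m =
    \sum_(j < n.+1) ((-1) ^+ (n - j) * 'C(n, j)%:R) *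
      ((\sum_i mu i) ^+ (n - j) * (\sum_i mu i * nu i - 1) ^+ m * (\sum_i nu i) ^+ j).
  move: (\sum_i nu i) (\sum_i mu i) (_ ^+ m) => y x z.
  rewrite addrC exprDn mulr_suml; apply: eq_bigr => j _.
  by rewrite (exprNn x) -[X in X * _ = _]mulr_natr; ring.
apply: form_symbol_sum => j _; apply: form_symbol_scale.
have Ag := symbol_sum_op (approx_eigen_calculus u) u_eig.
have Bg := symbol_sum_op (coapprox_eigen_calculus v) v_eig.
exact: form_symbol_comp (symbol_iter (approx_eigen_calculus u) (n - j) Ag)
  (symbol_iter (coapprox_eigen_calculus v) j Bg) (form_symbol_M_op m).
Qed.

End FormSymbol.

(** * Asymptotic orthogonality and the spectral inclusions *)

Section Isosymmetric.
Variables (R : realType) (H : hilbertType R) (d m n : nat).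
Local Notation C := R[i].
Variable T : 'I_d -> {linear H -> H}.
Hypotheses (T_bnd : forall i, bounded_operator (T i)) (T_iso : isosymmetric m n T).

Lemma cvg_inner_isosymmetric (mu mu' : 'rV[C]_d) (u v : nat -> H) :
  (exists K : C, forall k, `|u k| <= K) -> (exists K : C, forall k, `|v k| <= K) ->
  (forall l, (fun k => T l (u k) - mu 0 l *: u k) @ \oo --> (0 : H)) ->
  (forall l, (fun k => T l (v k) - mu' 0 l *: v k) @ \oo --> (0 : H)) ->
  \sum_(j < d) mu 0 j * (mu' 0 j)^* != 1 ->
  \sum_(j < d) (mu 0 j - (mu' 0 j)^*) != 0 ->
  (fun k => inner (u k) (v k) : C^o) @ \oo --> (0 : C^o).
Proof.
move=> ubnd vbnd Tu Tv mu1 mu0.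
have u_eig l : approx_eigen u (T l) (mu 0 l) by split=> //; exact: linearP.
have v_eig l : coapprox_eigen v (adjoint (T l)) (mu' 0 l)^*.
  exists (T l); last by rewrite conjCK; split=> //; exact: linearP.
  by move=> x y; rewrite dot_conj -adjointP // -dot_conj.
have := form_symbol_Lambda_op ubnd vbnd u_eig v_eig m n.
set c := _ * _.
have c0 : c != 0.
  rewrite mulf_neq0 // expf_neq0 ?subr_eq0 //.
  by move: mu0; rewrite sumrB subr_eq0 eq_sym.
(* With identity test operators, the inner product against [Lambda_op] vanishes, so [c] times
   [inner (u k) (v k)] tends to 0 and [c] can be divided out. *)
clearbody c; move=> /(_ _ _ _ _ (symbol_id (approx_eigen_calculus u))
               (symbol_id (approx_eigen_calculus v))) Lambda0.
have cK (x : C) : `|x| <= `|c|^-1 * `|c * x|.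
  by rewrite normrM mulrA mulVf ?mul1r // normr_eq0.
apply: (@cvg0_le C C^o C^o `|c|^-1) Lambda0 => k.
rewrite (proj2 T_iso) linear0l mul1r conjC1 mulr1 sub0r normrN; exact: cK.
Qed.

(** Outside both sets, orthogonality of [u] to itself would force the constant [c ^+ 2] to tend to
    0. A general [c] serves unit sequences and unnormalized eigenvectors alike. *)
Lemma isosymmetric_approx_spectrum (mu : 'rV[C]_d) (u : nat -> H) (c : C) :
  (forall k, `|u k| = c) -> c != 0 ->
  (forall l, (fun k => T l (u k) - mu 0 l *: u k) @ \oo --> (0 : H)) ->
  (@unit_sphere R d `|` @real_sum R d) mu.
Proof.
move=> uc c0 Tu; rewrite /unit_sphere /real_sum /=.
apply: contrapT => /not_orP[mu1 mu_real].
have ubnd : exists L : C, forall k, `|u k| <= L by exists c => k; rewrite uc.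
have := cvg_inner_isosymmetric ubnd ubnd Tu Tu.
under eq_bigr do rewrite -normCK.
move=> /(_ (introN eqP mu1)).
rewrite sumrB -rmorph_sum subr_eq0 eq_sym -CrealE => /(_ (introN idP mu_real)).
under eq_fun do rewrite inner_norm uc.
move=> /(norm_cvg_unique (V := C^o) (cvg_cst (c ^+ 2 : C^o)))/eqP.
by rewrite sqrf_eq0 (negbTE c0).
Qed.

End Isosymmetric.
Unset Implicit Arguments.


Theorem theorem3p2 (R : realType) (H : hilbertType R) (hH : separable H)
    (d m n : nat) (hd : (0 < d)%N) (hm : (0 < m)%N) (hn : (0 < n)%N)
    (T : 'I_d -> {linear H -> H}) (hT : forall i, bounded_operator (T i))
    (hiso : isosymmetric m n T) :
  [/\ joint_approx_spectrum T `<=` @unit_sphere R d `|` @real_sum R d,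
      joint_point_spectrum T `<=` @unit_sphere R d `|` @real_sum R d,
      (forall mu mu' : 'rV[R[i]]_d,
         joint_approx_spectrum T mu -> joint_approx_spectrum T mu' ->
         \sum_(j < d) mu 0 j * (mu' 0 j)^* != 1 ->
         \sum_(j < d) (mu 0 j - (mu' 0 j)^*) != 0 ->
         forall u v : nat -> H,
           (forall k, `|u k| = 1) -> (forall k, `|v k| = 1) ->
           (forall j, (fun k => `|T j (u k) - mu 0 j *: u k| : R[i]^o) @ \oo
                        --> (0 : R[i]^o)) ->
           (forall j, (fun k => `|T j (v k) - mu' 0 j *: v k| : R[i]^o) @ \oo
                        --> (0 : R[i]^o)) ->
           (fun k => inner (u k) (v k) : R[i]^o) @ \oo --> (0 : R[i]^o)) &
      (forall mu mu' : 'rV[R[i]]_d,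
         joint_point_spectrum T mu -> joint_point_spectrum T mu' ->
         \sum_(j < d) mu 0 j * (mu' 0 j)^* != 1 ->
         \sum_(j < d) (mu 0 j - (mu' 0 j)^*) != 0 ->
         forall u v : H,
           (forall j, T j u - mu 0 j *: u = 0) ->
           (forall j, T j v - mu' 0 j *: v = 0) ->
           inner u v = 0)].
Proof.
have const_bnd (x : H) : exists K : R[i], forall k : nat, `|x| <= K by exists `|x|.
have const_cvg (f : 'I_d -> H) : (forall l, f l = 0) ->
    forall l, (fun _ : nat => f l) @ \oo --> (0 : H).
  by move=> f0 l; rewrite f0; exact: cvg_cst.
split.
- move=> mu [u u1 Tu].
  exact: (isosymmetric_approx_spectrum hT hiso u1 (oner_neq0 _) Tu).
- move=> mu [u u0 Tu].
  apply: (isosymmetric_approx_spectrum hT hiso (u := fun=> u) (c := `|u|)) => //.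
    by rewrite normr_eq0.
  exact: const_cvg.
- move=> mu mu' _ _ mu1 mu0 u v u1 v1 Tu Tv.
  apply: (cvg_inner_isosymmetric hT hiso _ _ _ _ mu1 mu0).
  + by exists 1 => k; rewrite u1.
  + by exists 1 => k; rewrite v1.
  + by move=> l; apply/norm_cvg0P; exact: Tu.
  + by move=> l; apply/norm_cvg0P; exact: Tv.
(* The constant sequence [inner u v] tends to 0, so uniqueness of limits gives its value. *)
- move=> mu mu' _ _ mu1 mu0 u v Tu Tv.
  have := cvg_inner_isosymmetric hT hiso (const_bnd u) (const_bnd v)
    (const_cvg _ Tu) (const_cvg _ Tv) mu1 mu0.
  exact: (norm_cvg_unique (V := R[i]^o) (cvg_cst _)).
Qed.
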